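(* For every semigroup endomorphism $\varphi\colon\boldsymbol{B}_{\omega}\to\boldsymbol{B}_{\omega}$ of the bicyclic monoid (regarded as a semigroup) there exist $k,a\in\omega$ such that $\varphi=\varepsilon_{k[a]}$, i.e. $\varphi(m,n)=(km+a,\,kn+a)$ for all $m,n\in\omega$.
   Context: $\omega$ is the set of non-negative integers. The bicyclic monoid is realized as $\boldsymbol{B}_{\omega}=\omega\times\omega$ with operation $(i_1,j_1)\cdot(i_2,j_2)=(i_1+i_2-\min\{j_1,i_2\},\;j_1+j_2-\min\{j_1,i_2\})$ and identity $(0,0)$. A semigroup endomorphism is a multiplicative self-map (not required to preserve the identity). For $a,k\in\omega$, $\varepsilon_{k[a]}\colon\boldsymbol{B}_{\omega}\to\boldsymbol{B}_{\omega}$ is the map $(m,n)\mapsto(km+a,kn+a)$. *)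

(* Defs.v *)
From HB Require Import structures.
From mathcomp Require Import all_boot.
From mathcomp Require Import zify.

Set Implicit Arguments.
Unset Strict Implicit.
Unset Printing Implicit Defensive.

(* An alias of [nat * nat], so that its multiplication is not the
   componentwise one that the library puts on products. *)
Definition bicyclic : Type := (nat * nat)%type.

HB.instance Definition _ := Choice.copy bicyclic (nat * nat)%type.

(* The subtractions do not truncate: [minn p.2 q.1] is at most [p.2] and
   at most [q.1]. *)
Definition bicyclic_mul (p q : bicyclic) : bicyclic :=
  (p.1 + q.1 - minn p.2 q.1, p.2 + q.2 - minn p.2 q.1).

Definition bicyclic_one : bicyclic := (0, 0).

Lemma bicyclic_mulA : associative bicyclic_mul.
Proof.
by move=> [a b] [c d] [e f]; rewrite /bicyclic_mul /=; congr pair; lia.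
Qed.

Lemma bicyclic_mul1 : left_id bicyclic_one bicyclic_mul.
Proof. by move=> [a b]; rewrite /bicyclic_mul /=; congr pair; lia. Qed.

Lemma bicyclic_mulr1 : right_id bicyclic_one bicyclic_mul.
Proof. by move=> [a b]; rewrite /bicyclic_mul /=; congr pair; lia. Qed.

HB.instance Definition _ :=
  isMonoid.Build bicyclic bicyclic_mulA bicyclic_mul1 bicyclic_mulr1.

Definition eps (k a : nat) (p : bicyclic) : bicyclic :=
  (k * p.1 + a, k * p.2 + a).

(* Main.v *)
(** With q = (0,1) and p = (1,0) we have qp = 1 and (m,n) = p^m q^n.  The
    idempotent phi 1 is some (a,a); it acts as an identity on phi q and phi p,
    and phi q * phi p = phi 1, which forces phi q = (a, a+k) and
    phi p = (a+k, a). *)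
Require Import Defs.
From mathcomp Require Import all_boot.
From mathcomp Require Import zify.

Set Implicit Arguments.
Unset Strict Implicit.
Unset Printing Implicit Defensive.

Lemma bicyclic_idem (e : bicyclic) : bicyclic_mul e e = e -> e.2 = e.1.
Proof. by case: e => i j [] /=; lia. Qed.

(** The identity laws give [a <= x.1], [a <= x.2] and [a <= y.2]. In the product, [x.1 - a] and
    [y.1 - minn x.2 y.1] then sum to 0, as do [y.2 - a] and [x.2 - minn x.2 y.1]; hence
    [x.1 = y.2 = a] and [x.2 = y.1]. *)
Lemma bicyclic_local_inverse (a : nat) (x y : bicyclic) :
    bicyclic_mul (a, a) x = x -> bicyclic_mul x (a, a) = x ->
    bicyclic_mul y (a, a) = y ->
    bicyclic_mul x y = (a, a) ->
  exists k, x = (a, k + a) /\ y = (k + a, a).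
Proof.
case: x y => [x1 x2] [y1 y2] [] /= ax1 ax2 [] xa1 xa2 [] ya1 ya2 [] xy1 xy2.
by exists (x2 - a); split; congr pair; lia.
Qed.

Lemma bicyclic_endo_eps (f : bicyclic -> bicyclic) :
    {morph f : x y / bicyclic_mul x y} ->
  exists k a : nat, f =1 eps k a.
Proof.
move=> fM.
have [a f1] : exists a, f (0, 0) = (a, a).
  exists (f (0, 0)).1; have /esym/bicyclic_idem := fM (0, 0) (0, 0).
  by case: (f (0, 0)) => i j /= ->.
(* Each hypothesis is the image under [f] of a relation among [(0, 0)], [(0, 1)] and [(1, 0)] that
   holds by computation. *)
have [|||| k [fq fp]] := @bicyclic_local_inverse a (f (0, 1)) (f (1, 0)).
- by rewrite -f1 -fM.
- by rewrite -f1 -fM.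
- by rewrite -f1 -fM.
- by rewrite -f1 -fM.
have fqn n : f (0, n) = (a, k * n + a).
  elim: n => [|n IHn]; first by rewrite f1 muln0.
  have -> : (0, n.+1) = bicyclic_mul (0, n) (0, 1).
    by rewrite /bicyclic_mul /=; congr pair; lia.
  (* The inner coordinates [k * n + a] and [a] have minimum [a], so one copy of [a] cancels on each
     side. *)
  by rewrite fM IHn fq /bicyclic_mul /=; congr pair; lia.
have fpm m : f (m, 0) = (k * m + a, a).
  elim: m => [|m IHm]; first by rewrite f1 muln0.
  have -> : (m.+1, 0) = bicyclic_mul (1, 0) (m, 0).
    by rewrite /bicyclic_mul /=; congr pair; lia.
  by rewrite fM IHm fp /bicyclic_mul /=; congr pair; lia.
exists k, a => -[m n].
have -> : (m, n) = bicyclic_mul (m, 0) (0, n).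
  by rewrite /bicyclic_mul /=; congr pair; lia.
by rewrite fM fpm fqn /eps /bicyclic_mul /=; congr pair; lia.
Qed.

Theorem mainTheorem4 (phi : {multiplicative bicyclic -> bicyclic}) :
  exists k a : nat, phi =1 eps k a.
Proof. by apply: bicyclic_endo_eps => x y; apply: gmulfM. Qed.
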